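(* Let $c>0$ be a constant. Let $G=(V,E,L)$ be a graph with loops and let $(\mathcal{X},T)$, $\mathcal{X}=\{X_1,\dots,X_m\}$, be a tree decomposition of $G$ satisfying: (C1) each bag $X_j\in\mathcal{X}$ contains at most one node $i$ with $\{i,i\}\in L^+$; (C2) the width satisfies $\omega(\mathcal{X})\le c\log|V|$; (C3) for each plus loop $\{i,i\}\in L^+$, the spread satisfies $s_i(\mathcal{X})\le c\log|V|$. Then $\mathrm{QP}(G)$ has an SOC-representable formulation whose numbers of variables and constraints are bounded by a polynomial in $|V|$ (whose degree depends only on $c$).
   Context: A graph with loops is a triple $G=(V,E,L)$ where $V$ is a finite node set, $E$ is a set of unordered pairs of distinct nodes, and $L$ is a set of loops $\{i,i\}$, $i\in V$, partitioned as $L=L^-\cup L^+$ into minus and plus loops. Define $\mathrm{QP}(G):=\mathrm{conv}\{z\in\mathbb{R}^{V\cup E\cup L}: z_{ii}\ge z_i^2\ \forall\{i,i\}\in L^+,\ z_{ii}\le z_i^2\ \forall \{i,i\}\in L^-,\ z_{ij}=z_iz_j\ \forall \{i,j\}\in E,\ z_i\in[0,1]\ \forall i\in V\}$. A tree decomposition of $G$ (loops ignored) is a pair $(\mathcal{X},T)$ with $\mathcal{X}=\{X_1,\dots,X_m\}$ subsets of $V$ (bags) and $T$ a tree on the bags such that: $V=\bigcup_i X_i$; every edge $\{u,v\}\in E$ is contained in some bag; for every $v\in V$ the bags containing $v$ form a connected subtree of $T$. Its width $\omega(\mathcal{X})$ is the maximum bag size minus one. The spread of $v\in V$ is $s_v(\mathcal{X}):=\sum_{i\in[m]: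 v\in X_i}(|X_i|-1)$. A convex set is SOC-representable if it is the projection of a set described by finitely many linear constraints and (rotated) second-order cone constraints composed with affine maps; the size of the formulation is its number of variables and constraints. *)

(* Defs.v *)
From HB Require Import structures.
From mathcomp Require Import all_boot all_order all_algebra.
From mathcomp Require Import reals Rstruct exp.
Set Implicit Arguments. Unset Strict Implicit. Unset Printing Implicit Defensive.
Import Order.TTheory GRing.Theory Num.Theory.
Local Open Scope ring_scope.

Notation R := Rdefinitions.R.

(* An edge {i,j} (i <> j) is encoded as the ordered pair (i,j) with i < j.
   Plus loops {i,i} are encoded by i \in gLp, minus loops by i \in gLm. *)
Record graphL (n : nat) := GraphL {
  gE  : {set 'I_n * 'I_n};
  gLp : {set 'I_n};
  gLm : {set 'I_n};
  gE_wf : forall e, e \in gE -> (e.1 < e.2)%N;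
  gL_disj : [disjoint gLp & gLm]
}.

Definition gL n (G : graphL n) : {set 'I_n} := gLp G :|: gLm G.

Definition qpcoord n (G : graphL n) : finType :=
  ('I_n + ({e : 'I_n * 'I_n | e \in gE G} + {i : 'I_n | i \in gL G}))%type.

Definition QPbase n (G : graphL n) (z : qpcoord G -> R) : Prop :=
  (forall i (hi : i \in gLp G),
      z (inl i) ^+ 2 <= z (inr (inr (exist _ i (subsetP (subsetUl _ _) i hi))))) /\
  (forall i (hi : i \in gLm G),
      z (inr (inr (exist _ i (subsetP (subsetUr _ _) i hi)))) <= z (inl i) ^+ 2) /\
  (forall e (he : e \in gE G),
      z (inr (inl (exist _ e he))) = z (inl e.1) * z (inl e.2)) /\
  (forall i, 0 <= z (inl i) <= 1).

Definition conv_hull (I : finType) (S : (I -> R) -> Prop) (z : I -> R) : Prop :=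
  exists (k : nat) (lam : 'I_k -> R) (p : 'I_k -> I -> R),
    (forall t, 0 <= lam t) /\ \sum_(t < k) lam t = 1 /\
    (forall t, S (p t)) /\
    (forall x, z x = \sum_(t < k) lam t * p t x).

Definition QP n (G : graphL n) : (qpcoord G -> R) -> Prop := conv_hull (QPbase (G:=G)).

Definition is_tree (m : nat) (T : rel 'I_m) : Prop :=
  (0 < m)%N /\ symmetric T /\ irreflexive T /\
  (forall a b, connect T a b) /\
  #|[set p : 'I_m * 'I_m | T p.1 p.2 && (p.1 < p.2)%N]| = m.-1.

Definition tree_decomposition n (G : graphL n) (m : nat)
    (X : 'I_m -> {set 'I_n}) (T : rel 'I_m) : Prop :=
  is_tree T /\
  (forall v : 'I_n, exists j, v \in X j) /\
  (forall e, e \in gE G -> exists j, (e.1 \in X j) && (e.2 \in X j)) /\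
  (forall v : 'I_n, forall a b, v \in X a -> v \in X b ->
      connect [rel x y | [&& T x y, v \in X x & v \in X y]] a b).

Definition width n m (X : 'I_m -> {set 'I_n}) : nat :=
  (\max_(j < m) #|X j|).-1.

Definition spread n m (X : 'I_m -> {set 'I_n}) (v : 'I_n) : nat :=
  \sum_(j < m | v \in X j) (#|X j|).-1.

Record affF (I : finType) (k : nat) := AffF {
  afX : I -> R; afU : 'I_k -> R; af0 : R }.

Definition affE I k (a : affF I k) (x : I -> R) (u : 'I_k -> R) : R :=
  \sum_(i : I) afX a i * x i + \sum_(j < k) afU a j * u j + af0 a.

(* Second-order cone constraint  || (g_1(x,u), ..., g_p(x,u)) ||_2 <= h(x,u)
   with g_t, h affine (rotated cones are of this form after an affine map). *)
Record socC (I : finType) (k : nat) := SocC {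
  socDim : nat; socL : 'I_socDim -> affF I k; socR : affF I k }.

Definition socE I k (c : socC I k) (x : I -> R) (u : 'I_k -> R) : Prop :=
  Num.sqrt (\sum_(t < socDim c) affE (@socL _ _ c t) x u ^+ 2) <= affE (socR c) x u.

Record socForm (I : finType) := SocForm {
  nAux : nat;
  nIneq : nat; linIneq : 'I_nIneq -> affF I nAux;
  nEq : nat; linEq : 'I_nEq -> affF I nAux;
  nSoc : nat; socs : 'I_nSoc -> socC I nAux }.

Definition socForm_set I (F : socForm I) (x : I -> R) : Prop :=
  exists u : 'I_(nAux F) -> R,
    (forall t, 0 <= affE (@linIneq _ F t) x u) /\
    (forall t, affE (@linEq _ F t) x u = 0) /\
    (forall t, socE (@socs _ F t) x u).

Definition socForm_size I (F : socForm I) : nat :=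
  (#|I| + nAux F + nIneq F + nEq F + nSoc F)%N.

Definition SOC_formulation (I : finType) (S : (I -> R) -> Prop) (F : socForm I) : Prop :=
  forall x, S x <-> socForm_set F x.

Arguments QP {n} G _.
Arguments tree_decomposition {n} G {m} X T.

(* Main.v *)
(** Merge the bags meeting a given plus node [i] into one bag of at most spread-many nodes and
    drop the plus nodes; the result is still a tree decomposition along the same tree, its bags
    have O(log n) nodes, and the neighbourhood of each plus node lies in a single bag.
    Minimising a linear function over QP one may take all nodes other than plus nodes binary
    (independent Bernoulli rounding realises this for a given point), so a point of QP is a
    vector of moments of a random point that is binary outside the plus nodes. Such moments
    only involve the laws [lam B] of the traces on the bags, of which there are 2^O(log n)
    values, and, for a plus node [i], the expectations [y], [w] of x_i and x_i^2 on each event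
    of its bag, for which y^2 <= w lam is the only nonlinear constraint. Conversely, locally
    consistent laws on bags with the running intersection property glue to a global law, and
    x_i := y / lam, conditionally on the trace on the bag of [i], realises the moments. *)
Require Import Defs.
From HB Require Import structures.
From mathcomp Require Import all_boot all_order all_algebra.
From mathcomp Require Import boolp reals sequences Rstruct exp.
From mathcomp Require Import ring lra zify.
Set Implicit Arguments. Unset Strict Implicit. Unset Printing Implicit Defensive.
Import Order.TTheory GRing.Theory Num.Theory.

(** * Trees and the running intersection property *)

Definition restr (J : finType) (e : rel J) (A : {set J}) : rel J :=
  [rel x y | [&& e x y, x \in A & y \in A]].

Definition connected_in (J : finType) (e : rel J) (A : {set J}) : Prop :=
  forall a b, a \in A -> b \in A -> connect (restr e A) a b.

Lemma connected_in_step (J : finType) (e : rel J) (A : {set J}) (a b : J) :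
  connected_in e A -> a \in A -> b \in A -> a != b ->
  exists x, [/\ e a x & x \in A].
Proof.
move=> cA aA bA nab; case/connectP: (cA a b aA bA) => [[|x p]] /=.
  by move=> _ Eb; rewrite Eb eqxx in nab.
by case/andP=> /and3P[eax _ xA] _ _; exists x.
Qed.

(** A simple path through [k] would enter and leave it by two neighbours in [A]; these coincide,
    contradicting simplicity. So simple paths between the other vertices already avoid [k]. *)
Lemma connected_in_leaf (J : finType) (e : rel J) (A : {set J}) (k : J) :
  symmetric e ->
  (forall x y, x \in A -> y \in A -> e k x -> e k y -> x = y) ->
  connected_in e A -> connected_in e (A :\ k).
Proof.
move=> sym_e leaf cA a b /setD1P[nak aA] /setD1P[nbk bA].
case/connectP: (cA a b aA bA) => p0 /shortenP[p ep up _] Eb.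
have kp : k \notin p.
  apply/negP=> /splitPr Ep; case: Ep ep up Eb => p1 p2 ep up Eb.
  move: ep; rewrite cat_path => /= /and3P[_ e1 e2].
  case: p2 => [|y p2] in e2 up Eb *.
    by rewrite last_cat /= in Eb; rewrite Eb eqxx in nbk.
  move: e1 => /and3P[e1 l1A _]; move: e2 => /= /andP[/and3P[e2 _ yA] _].
  rewrite sym_e in e1; have Ey := leaf _ _ l1A yA e1 e2.
  move: up; rewrite -cat_cons cat_uniq => /and3P[_ /hasPn/(_ y)].
  by rewrite -Ey mem_last !inE eqxx !orbT => /(_ isT).
apply/connectP; exists p => //.
have: all (predC1 k) (a :: p).
  by rewrite /= nak /=; apply/allP=> x xp /=; apply: contraNneq kp => <-.
elim: p a {nak aA up Eb kp} ep => [//|x p IHp] a /=.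
case/andP=> /and3P[eax aA xA] ep /and3P[nak nxk ap].
apply/andP; split; last by apply: IHp => //=; rewrite nxk.
by rewrite /restr /= !inE eax nak nxk aA xA.
Qed.

(** Ordered pairs are counted, so for a symmetric relation each edge counts twice. Together with
    connectedness, the bound [(#|A|.-1).*2] expresses that [A] spans a subtree. *)
Definition arcs_in (J : finType) (e : rel J) (A : {set J}) : nat :=
  \sum_(x in A) \sum_(y in A) e x y.

Lemma arcs_inD1 (J : finType) (e : rel J) (A : {set J}) (k : J) :
  symmetric e -> irreflexive e -> k \in A ->
  arcs_in e A = ((\sum_(y in A) e k y).*2 + arcs_in e (A :\ k))%N.
Proof.
move=> sym_e irr_e kA; rewrite /arcs_in (big_setD1 k) //= -addnn -addnA; congr addn.
under eq_bigr do rewrite (big_setD1 k) //=.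
rewrite big_split /=; congr addn; rewrite [RHS](big_setD1 k) //= irr_e add0n.
by apply: eq_bigr => x _; rewrite sym_e.
Qed.

(** Handshake argument: if all degrees were at least 2, there would be at least [2 * #|A|] arcs. *)
Lemma exists_leaf (J : finType) (e : rel J) (A : {set J}) :
  A != set0 -> (arcs_in e A <= (#|A|.-1).*2)%N ->
  exists2 k, k \in A & (\sum_(y in A) e k y <= 1)%N.
Proof.
move=> A0 le_arcs; apply/exists_inP; apply: contraLR le_arcs => /exists_inPn noleaf.
rewrite -ltnNge; apply: (@leq_trans (#|A| * 2)).
  by rewrite muln2 ltn_double prednK ?card_gt0.
by rewrite -sum_nat_const; apply: leq_sum => k /noleaf; rewrite -ltnNge.
Qed.

(** The head is the bag attached last and [B'] is its parent. The list ends in [set0] so that a bag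
    disjoint from all earlier ones has a parent too. *)
Inductive running_intersection (V : finType) : seq {set V} -> Prop :=
| RunNil : running_intersection [:: set0]
| RunCons B B' s : running_intersection s -> B' \in s ->
    (forall D, D \in s -> B :&: D \subset B') -> running_intersection (B :: s).

Lemma set0_in_running_intersection (V : finType) (s : seq {set V}) :
  running_intersection s -> set0 \in s.
Proof. by elim=> [|B B' s' _ IHs _ _]; rewrite inE ?eqxx // IHs orbT. Qed.

(** Induction on [A] by removing a leaf [k]. The bag [Y k] is listed only if no listed bag contains
    it; each listed bag then brings a new node, which bounds the length by the number of nodes
    whatever the size of the tree. *)
Lemma running_intersection_of_tree (J V : finType) (e : rel J)
    (Y : J -> {set V}) (A : {set J}) :
  symmetric e -> irreflexive e -> (arcs_in e A <= (#|A|.-1).*2)%N ->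
  connected_in e A ->
  (forall v, connected_in e (A :&: [set j | v \in Y j])) ->
  exists s : seq {set V},
    [/\ running_intersection s, (size s <= #|\bigcup_(B <- s) B|.+1)%N,
        forall B, B \in s -> B = set0 \/ (exists2 j, j \in A & B = Y j)
      & forall j, j \in A -> exists2 B, B \in s & Y j \subset B].
Proof.
move=> sym_e irr_e; have [N] := ubnP #|A|; elim: N A => // N IHN A ltAN le_arcs cA cY.
have [->|A0] := eqVneq A set0.
  exists [:: set0]; split=> //; first exact: RunNil.
    by move=> B; rewrite inE => /eqP; left.
  by move=> j; rewrite inE.
have [k kA degk] := exists_leaf A0 le_arcs.
have leaf x y : x \in A -> y \in A -> e k x -> e k y -> x = y.
  move=> xA yA ekx eky; apply: contraTeq degk => nxy.
  rewrite (bigD1 x) //= (bigD1 y) /=; last by rewrite yA eq_sym.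
  by rewrite ekx eky.
have cardA : #|A| = #|A :\ k|.+1 by rewrite (cardsD1 k) kA.
have [||||s [rs ss sA As]] := IHN (A :\ k).
- by rewrite -ltnS -cardA.
(* If other vertices remain, connectedness gives [k] a neighbour, so its removal deletes at least
   two arcs. *)
- have := le_arcs; rewrite (arcs_inD1 sym_e irr_e kA) cardA /=.
  case: (posnP #|A :\ k|) => [/cards0_eq-> _|]; first by rewrite /arcs_in big_set0.
  rewrite card_gt0 => /set0Pn[l lAk] H.
  have [/negbTE nlk lA] := setD1P lAk.
  have [|x [ekx xA]] := connected_in_step cA kA lA; first by rewrite eq_sym nlk.
  by move: H; rewrite (bigD1 x) //= ekx; lia.
- exact: connected_in_leaf.
- move=> v; have -> : (A :\ k) :&: [set j | v \in Y j] = (A :&: [set j | v \in Y j]) :\ k.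
    by apply/setP=> j; rewrite !inE andbA.
  by apply: connected_in_leaf (cY v) => // x y; rewrite !inE =>
    /andP[xA _] /andP[yA _]; apply: leaf.
(* The vertices whose bags contain [v] are connected, so a node shared by the leaf bag and a listed
   bag also lies in the bag of a neighbour of [k]. *)
have step D v : D \in s -> v \in Y k -> v \in D -> exists x, [/\ e k x, x \in A & v \in Y x].
  move=> /sA[->|[j /setD1P[njk jA] ->]] vk; first by rewrite inE.
  move=> vj; have [|||] := @connected_in_step _ e _ k j (cY v).
  - by rewrite !inE kA.
  - by rewrite !inE jA.
  - by rewrite eq_sym.
  by move=> x [ekx]; rewrite !inE => /andP[xA vx]; exists x.
(* The parent is a listed bag containing the bag of the only neighbour of [k], or [set0] if [k] has
   no neighbour. *)
have [B' B's sepB] : exists2 B', B' \in s & forall D, D \in s -> Y k :&: D \subset B'.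
  case: (pickP [pred x in A | e k x]) => [x /andP[/= xA ekx]|nox].
    have [|B Bs sub] := As x.
      by rewrite !inE xA andbT; apply: contraTneq ekx => ->; rewrite irr_e.
    exists B => // D Ds; apply/subsetP=> v /setIP[vk vD]; apply: (subsetP sub).
    by have [x' [ekx' x'A vx']] := step D v Ds vk vD; rewrite (leaf x x').
  exists set0; first exact: set0_in_running_intersection.
  move=> D Ds; apply/subsetP=> v /setIP[vk vD].
  by have [x [ekx xA _]] := step D v Ds vk vD; have := nox x; rewrite /= xA ekx.
have AsU (s' : seq {set V}) : {subset s <= s'} -> (exists2 B, B \in s' & Y k \subset B) ->
    forall j, j \in A -> exists2 B, B \in s' & Y j \subset B.
  move=> ss' Bk j jA; have [->//|njk] := eqVneq j k.
  by have [|B Bs sub] := As j; [rewrite !inE njk | exists B => //; apply: ss'].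
case: (boolP (has [pred B : {set V} | Y k \subset B] s)) => [/hasP Bk|/hasPn nB].
  exists s; split=> //; last exact: AsU.
  by move=> B /sA[|[j /setD1P[_ jA] ->]]; [left | right; exists j].
exists (Y k :: s); split.
- exact: RunCons B's sepB.
(* Were all nodes of [Y k] already covered, [sepB] would put them all in [B'], against [nB]. *)
- apply: leq_trans (_ : #|\bigcup_(B <- s) B|.+2 <= _)%N => //.
  rewrite ltnS big_cons; apply: proper_card; rewrite properE subsetUr /=.
  apply: contra (nB _ B's) => sub /=; apply/subsetP=> v vk.
  have: v \in \bigcup_(B <- s) B by apply: (subsetP sub); rewrite inE vk.
  rewrite bigcup_seq => /bigcupP[D Ds vD].
  by apply: (subsetP (sepB D Ds)); rewrite inE vk.
- move=> B; rewrite inE => /predU1P[->|/sA[|[j /setD1P[_ jA] ->]]]; first by right; exists k.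
    by left.
  by right; exists j.
- apply: AsU; first by move=> B; rewrite inE orbC => ->.
  by exists (Y k); rewrite ?mem_head.
Qed.

Local Open Scope ring_scope.

(** * Gluing consistent local laws *)

(** The weights need not form a probability: with [mu o * X o i] the same sum is the expectation of
    x_i on the event that the trace on [B] is [b]. *)
Definition marginal (F : nmodType) (V O : finType) (mu : O -> F) (f : O -> {set V})
  (B b : {set V}) : F := \sum_(o | f o :&: B == b) mu o.

Lemma sum_marginal (F : pzSemiRingType) (V O : finType) (mu : O -> F) (f : O -> {set V})
    (B : {set V}) (h : {set V} -> F) :
  \sum_(b in powerset B) marginal mu f B b * h b = \sum_o mu o * h (f o :&: B).
Proof.
rewrite (partition_big (fun o => f o :&: B) (mem (powerset B))) /=; last first.
  by move=> o _; rewrite powersetE subsetIr.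
by apply: eq_bigr => b _; rewrite mulr_suml; apply: eq_bigr => o /eqP->.
Qed.

Lemma sum_marginal_set1 (F : pzSemiRingType) (V O : finType) (mu : O -> F)
    (f : O -> {set V}) (B C a : {set V}) :
  \sum_(b in powerset B | b :&: C == a) marginal mu f B b = marginal mu f (B :&: C) a.
Proof.
rewrite big_mkcondr /=.
under eq_bigr => b _ do
  rewrite -[marginal _ _ _ _]mulr1 -[0](mulr0 (marginal mu f B b)) -(fun_if ( *%R _)).
rewrite (sum_marginal mu f B (fun b => if b :&: C == a then 1 else 0)) [RHS]big_mkcond /=.
by apply: eq_bigr => o _; rewrite -setIA; case: ifP => _; rewrite ?mulr1 ?mulr0.
Qed.

(* The new bag is sampled, conditionally on its trace on the old bags, independently of
   the rest. *)
Lemma glue_marginals (F : realFieldType) (V : finType) (s : seq {set V})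
    (lam : {set V} -> {set V} -> F) :
  running_intersection s ->
  (forall B b, B \in s -> b \in powerset B -> 0 <= lam B b) ->
  (forall B, B \in s -> \sum_(b in powerset B) lam B b = 1) ->
  (forall B C a, B \in s -> C \in s -> a \in powerset (B :&: C) ->
     \sum_(b in powerset B | b :&: C == a) lam B b =
     \sum_(b in powerset C | b :&: B == a) lam C b) ->
  exists (O : finType) (mu : O -> F) (f : O -> {set V}),
    [/\ forall o, 0 <= mu o, \sum_o mu o = 1
      & forall B b, B \in s -> b \in powerset B -> marginal mu f B b = lam B b].
Proof.
elim=> [|B B' {}s rs IHs B's sepB] lam_ge0 lam1 lamC.
  exists unit, (fun=> 1), (fun=> set0); split=> [_|//|_ b /[!inE]/eqP->].
  - by [].
  - by rewrite big_const card_unit /= addr0.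
  rewrite subset0 => /eqP->; rewrite /marginal set0I eqxx big_const card_unit /= addr0.
  by rewrite -(lam1 set0) ?inE // powerset0 big_set1.
case: IHs => [C b Cs|C Cs|C D a Cs Ds|O [mu [f [mu_ge0 mu1 mu_marg]]]].
- by apply: lam_ge0; rewrite inE Cs orbT.
- by apply: lam1; rewrite inE Cs orbT.
- by apply: lamC; rewrite inE (Cs, Ds) orbT.
have Bs : B \in B :: s by rewrite mem_head.
have B's1 : B' \in B :: s by rewrite inE B's orbT.
pose C := B :&: B'.
pose lC a := \sum_(b in powerset B | b :&: B' == a) lam B b.
(* Consistency of [B] and [B']: the law glued so far has on the separator [C] the marginal
   prescribed by [lam B]. *)
have margC a : a \in powerset C -> marginal mu f C a = lC a.
  move=> aC; rewrite /lC (lamC B B' a) // /C setIC -sum_marginal_set1.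
  by apply: eq_bigr => b /andP[bB' _]; rewrite mu_marg.
have lC_ge0 a : 0 <= lC a by apply: sumr_ge0 => b /andP[bB _]; apply: lam_ge0.
pose nu (q : O * {set V}) : F :=
  if (q.2 \in powerset B) && (q.2 :&: B' == f q.1 :&: C)
  then mu q.1 * lam B q.2 / lC (q.2 :&: B') else 0.
pose g (q : O * {set V}) := (f q.1 :\: B) :|: q.2.
have nu_ge0 q : 0 <= nu q.
  rewrite /nu; case: ifP => [/andP[qB _]|//].
  by rewrite divr_ge0 ?mulr_ge0 ?lam_ge0.
(* An outcome over a separator trace of probability 0 has [mu o = 0], so the division by zero in
   [nu] loses no mass. *)
have nu_sum o : \sum_b nu (o, b) = mu o.
  rewrite /nu /= -big_mkcond /=.
  transitivity (mu o * (lC (f o :&: C) / lC (f o :&: C))).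
    rewrite {1}/lC mulr_suml mulr_sumr; apply: eq_bigr => b /andP[_ /eqP->].
    by rewrite mulrA.
  have [lC0|lC0] := eqVneq (lC (f o :&: C)) 0; last by rewrite divff ?mulr1.
  rewrite lC0 mul0r mulr0; apply/esym.
  move: lC0; rewrite -margC ?powersetE ?subsetIr // => /eqP.
  by rewrite psumr_eq0 // => /allP/(_ o (mem_index_enum _))/implyP/(_ (eqxx _))/eqP.
exists (O * {set V})%type, nu, g; split=> //.
  rewrite -[RHS]mu1 -(pair_bigA _ (fun o b => nu (o, b))) /=.
  by apply: eq_bigr => o _; rewrite nu_sum.
move=> D d /[!inE] /predU1P[-> | Ds] dD; rewrite /marginal.
  transitivity (\sum_o nu (o, d)).
    rewrite big_mkcond -(pair_bigA _ (fun o b => if g (o, b) :&: B == d then nu (o, b) else 0)) /=.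
    apply: eq_bigr => o _; rewrite (bigD1 d) //= big1 ?addr0 => [|b nbd].
      have -> : g (o, d) :&: B = d; last by rewrite eqxx.
      apply/setP=> v; rewrite !inE /=; have := subsetP dD v.
      by case: (v \in B) (v \in d) => [] [] //= H; rewrite ?andbF ?orbF //; have := H isT.
    case: ifP => // gd; rewrite /nu /=; case: ifP => // /andP[bB _].
    case/eqP: nbd; rewrite -(eqP gd); apply/setP=> v; rewrite !inE /=.
    rewrite powersetE in bB; have := subsetP bB v.
    by case: (v \in B) (v \in b) => [] [] //= H; rewrite ?andbF ?orbF //; have := H isT.
  rewrite /nu /= powersetE dD -big_mkcond /=.
  under eq_bigl do rewrite eq_sym.
  under eq_bigr do rewrite -mulrA.
  rewrite -mulr_suml -/(marginal mu f C (d :&: B')) margC; last by rewrite powersetE setSI.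
  have [lC0|lC0] := eqVneq (lC (d :&: B')) 0; last by rewrite mulrC divfK.
  rewrite lC0 mul0r; apply/esym; move/eqP: lC0.
  rewrite psumr_eq0 => [/allP/(_ d (mem_index_enum _))|b /andP[bB _]]; last exact: lam_ge0.
  by rewrite powersetE dD eqxx => /eqP.
rewrite -[RHS]mu_marg // ?powersetE // /marginal.
rewrite big_mkcond -(pair_bigA _ (fun o b => if g (o, b) :&: D == d then nu (o, b) else 0)) /=.
rewrite [RHS]big_mkcond; apply: eq_bigr => o _ /=.
rewrite -[in RHS]nu_sum.
transitivity (\sum_b (if f o :&: D == d then nu (o, b) else 0)); last first.
  by case: ifP => // _; rewrite big1.
apply: eq_bigr => b _; have [->|nu0] := eqVneq (nu (o, b)) 0; first by rewrite !if_same.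
(* Old bags keep their traces: [B] meets [D] only inside [B'], and there [b] agrees with [f o]
   wherever [nu] is nonzero. *)
suff -> : g (o, b) :&: D = f o :&: D by [].
move: nu0; rewrite /nu /=; case: ifP => [/andP[bB /eqP/setP bC] _|]; last by rewrite eqxx.
apply/setP=> v; have := bC v; rewrite !inE /=; rewrite powersetE in bB.
have := subsetP bB v; have := subsetP (sepB D Ds) v; rewrite !inE.
by case: (v \in B) (v \in b) (v \in D) (v \in B') (v \in f o) => [] [] [] [] [] //= sD sB eC;
  first [by have := sD isT | by have := sB isT].
Qed.

(** * Binary rounding outside the plus nodes *)

Definition bernoulli_weight (F : pzRingType) (V : finType) (q : V -> F) (S : {set V}) : F :=
  \prod_v (if v \in S then q v else 1 - q v).

(** Write each factor 1 outside [A] as [q v + (1 - q v)] and expand the product over all nodes. *)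
Lemma bernoulli_weight_supset (F : comPzRingType) (V : finType) (q : V -> F) (A : {set V}) :
  \sum_S bernoulli_weight q S * (A \subset S)%:R = \prod_(v in A) q v.
Proof.
rewrite [RHS]big_mkcond /=.
rewrite (eq_bigr (fun v => q v + (if v \in A then 0 else 1 - q v))); last first.
  by move=> v _; case: ifP => _; rewrite ?addr0 // addrC subrK.
rewrite bigA_distr; apply: eq_bigr => S _; rewrite /bernoulli_weight.
have [AS|/subsetPn[v vA vS]] := boolP (A \subset S).
  rewrite mulr1; apply: eq_bigr => v _; case: ifPn => // vS; case: ifP => // vA.
  by rewrite (subsetP AS) in vS.
by rewrite mulr0; apply/esym; rewrite (bigD1 v) //= (negbTE vS) vA mul0r.
Qed.

Lemma bernoulli_weight_ge0 (F : numDomainType) (V : finType) (q : V -> F) (S : {set V}) :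
  (forall v, 0 <= q v <= 1) -> 0 <= bernoulli_weight q S.
Proof.
move=> q01; apply: prodr_ge0 => v _.
by have /andP[q0 q1] := q01 v; case: ifP; rewrite // subr_ge0.
Qed.

(** Quantifying over the sigma types that index the coordinates removes the explicit membership
    proofs. *)
Lemma QPbaseP n (G : graphL n) (z : qpcoord G -> R) :
  QPbase z <->
  [/\ forall l : {i | i \in gL G}, if val l \in gLp G
        then z (inl (val l)) ^+ 2 <= z (inr (inr l))
        else z (inr (inr l)) <= z (inl (val l)) ^+ 2,
      forall e : {e | e \in gE G}, z (inr (inl e)) = z (inl (val e).1) * z (inl (val e).2)
    & forall v, 0 <= z (inl v) <= 1].
Proof.
split=> [[zp [zm [ze z01]]]|[zl ze z01]].
  split=> // [[i iL] /=|[e he] /=]; last exact: ze.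
  case: ifPn => [ip|inp]; first by rewrite (bool_irrelevance iL (subsetP (subsetUl _ _) i ip)).
  have im : i \in gLm G by move: (iL); rewrite inE (negbTE inp).
  by rewrite (bool_irrelevance iL (subsetP (subsetUr _ _) i im)).
split=> [i ip|]; first by have := zl (exist _ i (subsetP (subsetUl _ _) i ip)); rewrite /= ip.
split=> [i im|]; last by split=> // e he; have := ze (exist _ e he).
have := zl (exist _ i (subsetP (subsetUr _ _) i im)) => /=.
by rewrite (disjointFl (gL_disj G) im).
Qed.

Definition mixed_point n (G : graphL n) (O : finType) (f : O -> {set 'I_n})
    (X : O -> 'I_n -> R) (o : O) (v : 'I_n) : R :=
  if v \in gLp G then X o v else (v \in f o)%:R.

(* z is the vector of moments of a random point whose coordinates other than the plus
   nodes are binary. *)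
Definition mixed_moments n (G : graphL n) (O : finType) (mu : O -> R)
    (f : O -> {set 'I_n}) (X : O -> 'I_n -> R) (z : qpcoord G -> R) : Prop :=
  let x := mixed_point G f X in
  [/\ (forall o, 0 <= mu o) /\ \sum_o mu o = 1,
      forall o v, 0 <= X o v <= 1,
      forall v, z (inl v) = \sum_o mu o * x o v,
      forall e : {e | e \in gE G},
        z (inr (inl e)) = \sum_o mu o * (x o (val e).1 * x o (val e).2)
    & forall l : {i | i \in gL G}, if val l \in gLp G
        then \sum_o mu o * x o (val l) ^+ 2 <= z (inr (inr l))
        else z (inr (inr l)) <= z (inl (val l))].

(** Plus coordinates stay constant at [q] and the others are independent Bernoulli variables, so
    means and products over distinct nodes are preserved. *)
Lemma sum_bernoulli_mixed_point n (G : graphL n) (q : 'I_n -> R) :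
  let x := mixed_point G id (fun=> q) in
  [/\ \sum_S bernoulli_weight q S = 1,
      forall v, \sum_S bernoulli_weight q S * x S v = q v
    & forall v w, v != w -> \sum_S bernoulli_weight q S * (x S v * x S w) = q v * q w].
Proof.
move=> x.
have E0 : \sum_S bernoulli_weight q S = 1.
  have := bernoulli_weight_supset q set0; rewrite big_set0 => <-.
  by apply: eq_bigr => S _; rewrite sub0set mulr1.
have E1 u : \sum_S bernoulli_weight q S * x S u = q u.
  rewrite /x /mixed_point; case: (u \in gLp G); first by rewrite -[RHS]mul1r -E0 mulr_suml.
  have := bernoulli_weight_supset q [set u]; rewrite big_set1 => <-.
  by apply: eq_bigr => S _; rewrite sub1set.
split=> // v w nvw.
have [wp|wnp] := boolP (w \in gLp G).
  rewrite -(E1 v) mulr_suml; apply: eq_bigr => S _.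
  by rewrite -mulrA; congr (_ * (_ * _)); rewrite /x /mixed_point wp.
have [vp|vnp] := boolP (v \in gLp G).
  rewrite -(E1 w) mulr_sumr; apply: eq_bigr => S _.
  by rewrite mulrCA; congr (_ * _); rewrite /x /mixed_point vp.
have := bernoulli_weight_supset q [set v; w].
rewrite big_setU1 ?inE //= big_set1 => <-; apply: eq_bigr => S _; congr (_ * _).
rewrite /x /mixed_point (negbTE vnp) (negbTE wnp) subUset !sub1set.
by case: (v \in S); rewrite ?mul1r ?mul0r.
Qed.

(** Rounding can only raise the second moment of a node, which is harmless for minus loops; plus
    nodes are left unrounded. As x^2 = x for binary values, a minus loop constraint becomes linear
    in the moments. *)
Lemma QP_mixed_moments n (G : graphL n) (z : qpcoord G -> R) :
  QP G z <-> exists (O : finType) (mu : O -> R) (f : O -> {set 'I_n}) (X : O -> 'I_n -> R),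
    mixed_moments mu f X z.
Proof.
split=> [[k [lam [p [lam_ge0 [lam1 [pQP zE]]]]]]|].
  pose q t v := p t (inl v).
  have q01 t v : 0 <= q t v <= 1 by have [_ _] := (QPbaseP (p t)).1 (pQP t); apply.
  exists ('I_k * {set 'I_n})%type, (fun o => lam o.1 * bernoulli_weight (q o.1) o.2),
    snd, (fun o => q o.1).
  have sumE (h : 'I_k -> {set 'I_n} -> R) (H : 'I_k -> R) :
      (forall t, \sum_S bernoulli_weight (q t) S * h t S = H t) ->
      \sum_o lam o.1 * bernoulli_weight (q o.1) o.2 * h o.1 o.2 = \sum_t lam t * H t.
    move=> hH; rewrite -(pair_bigA _ (fun t S => lam t * bernoulli_weight (q t) S * h t S)) /=.
    apply: eq_bigr => t _; rewrite -hH mulr_sumr.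
    by apply: eq_bigr => S _; rewrite mulrA.
  have EW t := sum_bernoulli_mixed_point G (q t).
  have xE o : mixed_point G snd (fun o => q o.1) o =
      mixed_point G id (fun=> q o.1) o.2 by [].
  split=> [|o v|v|e|l]; last first.
  - case: ifPn => lp; last first.
      rewrite !zE; apply: ler_sum => t _; apply: ler_wpM2l => //.
      have [/(_ l) + _ _] := (QPbaseP (p t)).1 (pQP t); rewrite (negbTE lp) => /le_trans; apply.
      by have /andP[q0 q1] := q01 t (val l); rewrite expr2 ler_piMl.
    rewrite zE; apply: le_trans (_ : \sum_t lam t * q t (val l) ^+ 2 <= _).
      rewrite -(sumE (fun t _ => q t (val l) ^+ 2)) /mixed_point ?lp //.
      by move=> t; have [W1 _ _] := EW t; rewrite -mulr_suml W1 mul1r.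
    apply: ler_sum => t _; apply: ler_wpM2l => //.
    by have [/(_ l) + _ _] := (QPbaseP (p t)).1 (pQP t); rewrite lp.
  - rewrite zE (sumE (fun t S => mixed_point G id (fun=> q t) S (val e).1 *
                                  mixed_point G id (fun=> q t) S (val e).2)
                     (fun t => q t (val e).1 * q t (val e).2)).
      by apply: eq_bigr => t _; have [_ -> _] := (QPbaseP (p t)).1 (pQP t).
    move=> t; have [_ _ ->//] := EW t.
    by have := gE_wf (valP e); apply: contraTneq => ->; rewrite ltnn.
  - by rewrite zE (sumE (fun t S => mixed_point G id (fun=> q t) S v) (q^~ v)) // => t;
      have [_ ->] := EW t.
  - exact: q01.
  - split=> [o|]; first by rewrite mulr_ge0 ?bernoulli_weight_ge0.
    rewrite -[RHS]lam1 -(pair_bigA _ (fun t S => lam t * bernoulli_weight (q t) S)) /=.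
    by apply: eq_bigr => t _; have [W1 _ _] := EW t; rewrite -mulr_sumr W1 mulr1.
case=> O [mu [f [X [[mu_ge0 mu1] X01 zv ze zl]]]].
set x := mixed_point G f X in zv ze zl.
have sum_enum (h : O -> R) : \sum_(t < #|O|) h (enum_val t) = \sum_o h o.
  by rewrite [RHS](reindex _ (onW_bij _ (@enum_val_bij O))).
(* The slack of a loop coordinate is added equally to all outcomes, so that the average is exactly
   [z]; its sign is the one the loop requires. *)
pose P o (c : qpcoord G) : R := match c with
  | inl v => x o v
  | inr (inl e) => x o (val e).1 * x o (val e).2
  | inr (inr l) => x o (val l) ^+ 2 + (z c - \sum_o mu o * x o (val l) ^+ 2)
  end.
exists #|O|, (fun t => mu (enum_val t)), (fun t => P (enum_val t)); split=> //.
split; first by rewrite sum_enum.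
split=> [t|c]; last first.
  rewrite (sum_enum (fun o => mu o * P o c)); case: c => [v|[e|l]] /=; rewrite ?zv ?ze //.
  under eq_bigr do rewrite mulrDr.
  by rewrite big_split /= -mulr_suml mu1 mul1r addrC subrK.
apply/QPbaseP; split=> [l|e|v] //=.
  have := zl l; case: ifPn => lp; first by rewrite -subr_ge0 => h; rewrite lerDl.
  rewrite zv -subr_le0 => h; rewrite gerDl; congr (_ - _ <= 0): h.
  apply: eq_bigr => o _; congr (_ * _); rewrite /x /mixed_point (negbTE lp).
  by case: (_ \in _); rewrite ?expr1n ?expr0n.
by rewrite /x /mixed_point; case: ifP => // _; case: (_ \in _); rewrite ?lexx ?ler01.
Qed.

(** * Sets described by second-order cone constraints *)

(** Coefficients form a finite function so that constraints have decidable equality and lists of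
    them support membership. *)
Notation aff J := ({ffun J -> R} * R)%type.

Definition aff_eval (J : finType) (a : aff J) (x : J -> R) : R :=
  \sum_j a.1 j * x j + a.2.

Definition affine (J : finType) (g : (J -> R) -> R) : Prop :=
  exists a : aff J, forall x, g x = aff_eval a x.

Lemma affine_cst (J : finType) (r : R) : affine (fun _ : J -> R => r).
Proof.
exists ([ffun=> 0], r) => x; rewrite /aff_eval big1 ?add0r // => j _.
by rewrite ffunE mul0r.
Qed.

Lemma affine_coord (J : finType) (j : J) : affine (fun x : J -> R => x j).
Proof.
exists ([ffun i => (i == j)%:R], 0) => x; rewrite /aff_eval addr0 (bigD1 j) //= big1.
  by rewrite ffunE eqxx mul1r addr0.
by move=> i /negbTE nij; rewrite ffunE nij mul0r.
Qed.

Lemma affineD (J : finType) (g h : (J -> R) -> R) :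
  affine g -> affine h -> affine (fun x => g x + h x).
Proof.
move=> [a ga] [b hb]; exists ([ffun j => a.1 j + b.1 j], a.2 + b.2) => x.
rewrite ga hb /aff_eval addrACA -big_split /=; congr (_ + _).
by apply: eq_bigr => j _; rewrite ffunE mulrDl.
Qed.

Lemma affineZ (J : finType) (r : R) (g : (J -> R) -> R) :
  affine g -> affine (fun x => r * g x).
Proof.
move=> [a ga]; exists ([ffun j => r * a.1 j], r * a.2) => x.
rewrite ga /aff_eval mulrDr mulr_sumr; congr (_ + _).
by apply: eq_bigr => j _; rewrite ffunE mulrA.
Qed.

Lemma affineMr (J : finType) (r : R) (g : (J -> R) -> R) :
  affine g -> affine (fun x => g x * r).
Proof. by move=> /(affineZ r)[a ga]; exists a => x; rewrite -ga mulrC. Qed.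

Lemma affineB (J : finType) (g h : (J -> R) -> R) :
  affine g -> affine h -> affine (fun x => g x - h x).
Proof.
move=> ag ah; have [a ga] := affineD ag (affineZ (-1) ah).
by exists a => x; rewrite -ga mulN1r.
Qed.

Lemma affine_sum (J T : finType) (P : pred T) (g : T -> (J -> R) -> R) :
  (forall t, P t -> affine (g t)) -> affine (fun x => \sum_(t | P t) g t x).
Proof.
move=> ag; have ag' t : affine (fun x => if P t then g t x else 0).
  by case: (boolP (P t)) => [/ag//|_]; apply: affine_cst.
have [a ga] : affine (fun x => \sum_(t <- index_enum T) if P t then g t x else 0).
  elim: (index_enum T) => [|t l [b gb]].
    by have [b gb] := affine_cst J 0; exists b => x; rewrite big_nil; apply: gb.
  have [c gc] : affine (fun x => (if P t then g t x else 0) + aff_eval b x).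
    by apply: affineD => //; exists b.
  by exists c => x; rewrite big_cons gb gc.
by exists a => x; rewrite -ga big_mkcond.
Qed.

Definition soc_sat (J : finType) (c : seq (aff J) * aff J) (x : J -> R) : Prop :=
  Num.sqrt (\sum_(a <- c.1) aff_eval a x ^+ 2) <= aff_eval c.2 x.

(** A linear inequality is a cone constraint with an empty vector, so one counter [k] covers all
    constraints; an equation counts twice. *)
Definition soc_set (J : finType) (k : nat) (S : (J -> R) -> Prop) : Prop :=
  exists2 cs : seq (seq (aff J) * aff J), (size cs <= k)%N &
    forall x, S x <-> (forall c, c \in cs -> soc_sat c x).

Lemma soc_set_ge0 (J : finType) (g : (J -> R) -> R) :
  affine g -> soc_set 1 (fun x => 0 <= g x).
Proof.
move=> [a ga]; exists [:: ([::], a)] => // x; rewrite ga; split=> [a0 c|/(_ ([::], a))].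
  by rewrite inE => /eqP->; rewrite /soc_sat big_nil sqrtr0.
by rewrite inE eqxx /soc_sat big_nil sqrtr0; apply.
Qed.

Lemma soc_set_and (J : finType) (k l : nat) (S T : (J -> R) -> Prop) :
  soc_set k S -> soc_set l T -> soc_set (k + l) (fun x => S x /\ T x).
Proof.
move=> [cs szs Scs] [ct szt Tct]; exists (cs ++ ct); first by rewrite size_cat leq_add.
move=> x; rewrite Scs Tct; split=> [[Sx Tx] c|ST].
  by rewrite mem_cat => /orP[/Sx|/Tx].
by split=> c cx; apply: ST; rewrite mem_cat cx ?orbT.
Qed.

Lemma soc_set_iff (J : finType) (k : nat) (S T : (J -> R) -> Prop) :
  (forall x, S x <-> T x) -> soc_set k S -> soc_set k T.
Proof. by move=> ST [cs szs Scs]; exists cs => // x; rewrite -ST. Qed.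

Lemma soc_set_leq (J : finType) (k l : nat) (S : (J -> R) -> Prop) :
  (k <= l)%N -> soc_set k S -> soc_set l S.
Proof. by move=> kl [cs szs Scs]; exists cs => //; apply: leq_trans kl. Qed.

Lemma soc_set_le (J : finType) (g h : (J -> R) -> R) :
  affine g -> affine h -> soc_set 1 (fun x => g x <= h x).
Proof.
move=> ag ah; apply: soc_set_iff (soc_set_ge0 (affineB ah ag)) => x.
by rewrite subr_ge0.
Qed.

Lemma soc_set_eq (J : finType) (g h : (J -> R) -> R) :
  affine g -> affine h -> soc_set 2 (fun x => g x = h x).
Proof.
move=> ag ah; apply: soc_set_iff (soc_set_and (soc_set_le ag ah) (soc_set_le ah ag)) => x.
by split=> [[gh hg]|->//]; apply/eqP; rewrite eq_le gh.
Qed.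

(* y^2 <= w l is the cone || (2 y, w - l) || <= w + l. *)
Lemma soc_set_rotated (J : finType) (y w l : (J -> R) -> R) :
  affine y -> affine w -> affine l ->
  soc_set 1 (fun x => [/\ 0 <= w x, 0 <= l x & y x ^+ 2 <= w x * l x]).
Proof.
move=> ay aw al.
have [a aE] := affineZ 2 ay; have [b bE] := affineB aw al; have [c cE] := affineD aw al.
exists [:: ([:: a; b], c)] => // x.
have -> : (forall d, d \in [:: ([:: a; b], c)] -> soc_sat d x) <-> soc_sat ([:: a; b], c) x.
  by split=> [|h d]; [apply; rewrite inE | rewrite inE => /eqP->].
rewrite /soc_sat !big_cons big_nil addr0 -aE -bE -cE /=.
have idt : (2 * y x) ^+ 2 + (w x - l x) ^+ 2 = (w x + l x) ^+ 2 - 4 * (w x * l x - y x ^+ 2).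
  by ring.
split=> [[w0 l0 ywl]|h].
  rewrite -[leRHS]ger0_norm ?addr_ge0 // -sqrtr_sqr ler_sqrt ?sqr_ge0 // idt.
  by rewrite gerBl mulr_ge0 // subr_ge0.
have wl0 : 0 <= w x + l x by apply: le_trans h; apply: sqrtr_ge0.
have ywl : y x ^+ 2 <= w x * l x.
  have := h; rewrite -(ler_sqr) ?nnegrE ?sqrtr_ge0 // sqr_sqrtr ?addr_ge0 ?sqr_ge0 //.
  by rewrite idt gerBl pmulr_rge0 ?subr_ge0.
(* A nonnegative product and a nonnegative sum force both factors to be nonnegative. *)
have := le_trans (sqr_ge0 (y x)) ywl => wl.
by split=> //; nra.
Qed.

Lemma soc_set_all_seq (J : finType) (T : eqType) (r : seq T) (k : nat)
    (S : T -> (J -> R) -> Prop) :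
  (forall t, t \in r -> soc_set k (S t)) ->
  soc_set (size r * k) (fun x => forall t, t \in r -> S t x).
Proof.
elim: r => [|t r IHr] Sk; first by exists [::] => // x; split.
rewrite mulSn; apply: soc_set_iff (soc_set_and (Sk t (mem_head _ _)) (IHr _)) => [x|u ur].
  split=> [[St Sr] u|h]; first by rewrite inE => /predU1P[->|/Sr].
  by split=> [|u ur]; apply: h; rewrite inE ?eqxx ?ur ?orbT.
by apply: Sk; rewrite inE ur orbT.
Qed.

Lemma soc_set_all (J T : finType) (A : {set T}) (k : nat) (S : T -> (J -> R) -> Prop) :
  (forall t, t \in A -> soc_set k (S t)) ->
  soc_set (#|A| * k) (fun x => forall t, t \in A -> S t x).
Proof.
move=> Sk; rewrite cardE; apply: soc_set_iff (soc_set_all_seq (r := enum A) _) => [x|t].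
  by split=> h t tA; apply: h; rewrite mem_enum in tA *.
by rewrite mem_enum; apply: Sk.
Qed.

Lemma soc_set_forall (J T : finType) (k : nat) (S : T -> (J -> R) -> Prop) :
  (forall t, soc_set k (S t)) -> soc_set (#|T| * k) (fun x => forall t, S t x).
Proof.
move=> Sk; rewrite -cardsT; apply: soc_set_iff (soc_set_all (fun t _ => Sk t)) => x.
by split=> h t => [|_]; apply: h; rewrite ?inE.
Qed.

Lemma soc_set_imply (J : finType) (b : bool) (k : nat) (S : (J -> R) -> Prop) :
  (b -> soc_set k S) -> soc_set k (fun x => b -> S x).
Proof.
case: b => [/(_ isT)|_]; last by exists [::] => // x; split.
by apply: soc_set_iff => x; split=> [//|/(_ isT)].
Qed.

Definition join_point (I Q : finType) (x : I -> R) (u : Q -> R) (c : I + Q) : R :=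
  match c with inl i => x i | inr q => u q end.

(** The type [Q] of keys may be exponentially large. Variables outside [D] are fixed to 0, and only
    those in [D] become auxiliary variables of the formulation. *)
Lemma soc_set_projection (I Q : finType) (D : pred Q) (k : nat)
    (S : (I + Q -> R) -> Prop) :
  soc_set k S ->
  exists F : socForm I, (socForm_size F <= #|I| + #|D| + k)%N /\
    forall x, socForm_set F x <->
      exists u : Q -> R, (forall q, ~~ D q -> u q = 0) /\ S (join_point x u).
Proof.
case=> cs szs Scs.
pose toF (a : aff (I + Q)%type) : affF I #|D| :=
  AffF (fun i => a.1 (inl i)) (fun j => a.1 (inr (enum_val j))) a.2.
pose toC (c : seq (aff (I + Q)%type) * aff (I + Q)%type) : socC I #|D| :=
  SocC (fun t => toF (tnth (in_tuple c.1) t)) (toF c.2).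
pose noF (t : 'I_0) : affF I #|D| := AffF (fun=> 0) (fun=> 0) 0.
pose F := SocForm noF noF (fun t => toC (tnth (in_tuple cs) t)).
have toFE a x (u : Q -> R) : (forall q, ~~ D q -> u q = 0) ->
    affE (toF a) x (fun j => u (enum_val j)) = aff_eval a (join_point x u).
  move=> u0; rewrite /affE /aff_eval big_sumType /=; congr (_ + _ + _).
  rewrite -(big_enum_val (fun q => a.1 (inr q) * u q)) /= big_mkcond /=.
  by apply: eq_bigr => q _; rewrite unfold_in; case: ifPn => // /u0->; rewrite mulr0.
have toCE c x (u : Q -> R) : (forall q, ~~ D q -> u q = 0) ->
    socE (toC c) x (fun j => u (enum_val j)) <-> soc_sat c (join_point x u).
  move=> u0; rewrite /socE /soc_sat /= toFE // (big_tnth _ _ c.1).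
  by under eq_bigr do rewrite toFE //.
have FE x (u : Q -> R) : (forall q, ~~ D q -> u q = 0) ->
    S (join_point x u) <-> forall t, socE (@socs _ F t) x (fun j => u (enum_val j)).
  move=> u0; rewrite Scs; split=> [h t|h c /(tnthP (in_tuple cs))[t ->]].
    exact/toCE/h/mem_tnth.
  exact/toCE/h.
exists F; split; first by rewrite /socForm_size /= !addn0 leq_add2l.
move=> x; split=> [[v [_ [_ hv]]]|[u [u0 /(FE _ _ u0) hu]]]; last first.
  by exists (fun j => u (enum_val j)); split=> [[]|] //; split=> [[]|].
(* Extension of [v] by zero: the sum has one term on [D] and none elsewhere. *)
pose u q : R := \sum_(j < #|D| | enum_val j == q) v j.
have u0 q : ~~ D q -> u q = 0.
  move=> nDq; apply: big_pred0 => j; apply: contraNF nDq => /eqP<-.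
  exact: enum_valP j.
have uE : (fun j => u (enum_val j)) = v.
  by apply/funext=> j; rewrite /u (big_pred1 j) // => i; rewrite (inj_eq enum_val_inj).
by exists u; split=> //; apply/FE; rewrite ?uE.
Qed.

(** * Local moments *)

(** Each plus node is attached to one bag containing all its neighbours. The last clause also
    excludes edges between two plus nodes. *)
Definition adapted_bags n (G : graphL n) (s : seq {set 'I_n}) (beta : 'I_n -> {set 'I_n}) :=
  [/\ running_intersection s,
      forall v, v \notin gLp G -> exists2 B, B \in s & v \in B,
      forall e, e \in gE G -> e.1 \notin gLp G -> e.2 \notin gLp G ->
        exists B, [/\ B \in s, e.1 \in B & e.2 \in B],
      forall i, i \in gLp G -> beta i \in s
    & forall e, e \in gE G ->
        (e.1 \in gLp G -> e.2 \notin gLp G /\ e.2 \in beta e.1) /\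
        (e.2 \in gLp G -> e.1 \notin gLp G /\ e.1 \in beta e.2)].

(* lam B b is the probability that exactly the nodes of b are 1 among those of the bag B;
   y i b and w i b are the expectations of x_i and x_i^2 on that event for the bag beta i. *)
Definition local_moments n (G : graphL n) (s : seq {set 'I_n}) (beta : 'I_n -> {set 'I_n})
    (z : qpcoord G -> R) (lam : {set 'I_n} -> {set 'I_n} -> R)
    (y w : 'I_n -> {set 'I_n} -> R) : Prop :=
  (forall B, B \in s ->
     (forall b, b \in powerset B -> 0 <= lam B b) /\
     (\sum_(b in powerset B) lam B b = 1 /\
      forall C, C \in s -> forall a, a \in powerset (B :&: C) ->
        \sum_(b in powerset B | b :&: C == a) lam B b =
        \sum_(b in powerset C | b :&: B == a) lam C b)) /\
  ((forall v, v \notin gLp G -> forall B, B \in s -> v \in B ->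
      z (inl v) = \sum_(b in powerset B) lam B b * (v \in b)%:R) /\
  ((forall e : {e | e \in gE G}, (val e).1 \notin gLp G -> (val e).2 \notin gLp G ->
      forall B, B \in s -> (val e).1 \in B -> (val e).2 \in B ->
      z (inr (inl e)) =
      \sum_(b in powerset B) lam B b * (((val e).1 \in b)%:R * ((val e).2 \in b)%:R)) /\
  ((forall i, i \in gLp G ->
      (forall b, b \in powerset (beta i) ->
         (0 <= y i b /\ y i b <= lam (beta i) b) /\
         [/\ 0 <= w i b, 0 <= lam (beta i) b & y i b ^+ 2 <= w i b * lam (beta i) b]) /\
      z (inl i) = \sum_(b in powerset (beta i)) y i b) /\
  ((forall e : {e | e \in gE G},
      ((val e).1 \in gLp G -> z (inr (inl e)) =
         \sum_(b in powerset (beta (val e).1)) y (val e).1 b * ((val e).2 \in b)%:R) /\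
      ((val e).2 \in gLp G -> z (inr (inl e)) =
         \sum_(b in powerset (beta (val e).2)) y (val e).2 b * ((val e).1 \in b)%:R)) /\
  (forall l : {i | i \in gL G}, if val l \in gLp G
     then \sum_(b in powerset (beta (val l))) w (val l) b <= z (inr (inr l))
     else z (inr (inr l)) <= z (inl (val l))))))).

(** With M, A, B the three sums, the sum of [mu o * (M * x o - A) ^+ 2] equals M (B M - A^2); divide
    by M, the case M = 0 being trivial. *)
Lemma weighted_cauchy_schwarz (F : realFieldType) (O : finType) (P : pred O) (mu x : O -> F) :
  (forall o, 0 <= mu o) ->
  (\sum_(o | P o) mu o * x o) ^+ 2 <=
  (\sum_(o | P o) mu o * x o ^+ 2) * \sum_(o | P o) mu o.
Proof.
move=> mu_ge0; set A := \sum_(o | P o) mu o * x o; set B := \sum_(o | P o) mu o * x o ^+ 2.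
set M := \sum_(o | P o) mu o.
have [M0|M_gt0] := eqVneq M 0.
  suff -> : A = 0 by rewrite M0 mulr0 expr0n.
  apply: big1 => o Po; move/eqP: M0; rewrite psumr_eq0 // => /allP/(_ o (mem_index_enum _)).
  by rewrite Po => /eqP->; rewrite mul0r.
have {}M_gt0 : 0 < M by rewrite lt_def M_gt0 sumr_ge0.
suff : 0 <= M * (B * M - A ^+ 2) by rewrite pmulr_rge0 // subr_ge0.
have : 0 <= \sum_(o | P o) mu o * (M * x o - A) ^+ 2.
  by apply: sumr_ge0 => o _; rewrite mulr_ge0 ?sqr_ge0.
congr (0 <= _).
transitivity (\sum_(o | P o)
    (M ^+ 2 * (mu o * x o ^+ 2) - 2 * M * A * (mu o * x o) + A ^+ 2 * mu o)).
  by apply: eq_bigr => o _; ring.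
rewrite big_split sumrB /= -!mulr_sumr -/A -/B -/M; ring.
Qed.

Lemma marginal_outside (F : nmodType) (V O : finType) (mu : O -> F) (f : O -> {set V})
    (B b : {set V}) : b \notin powerset B -> marginal mu f B b = 0.
Proof.
move=> nbB; apply: big_pred0 => o; apply: contraNF nbB => /eqP<-.
by rewrite powersetE subsetIr.
Qed.

(** The marginals of a random point are locally consistent, and the cone constraint is
    Cauchy-Schwarz on each event. The vanishing clauses provide the zero values that
    [soc_set_projection] demands off the domain. *)
Lemma mixed_moments_local n (G : graphL n) s beta (z : qpcoord G -> R)
    (O : finType) (mu : O -> R) (f : O -> {set 'I_n}) (X : O -> 'I_n -> R) :
  adapted_bags G s beta -> mixed_moments mu f X z ->
  exists lam y w,
    [/\ local_moments s beta z lam y w,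
        forall (B b : {set 'I_n}), ~~ ((B \in s) && (b \subset B)) -> lam B b = 0
      & forall i (b : {set 'I_n}), ~~ ((i \in gLp G) && (b \subset beta i)) ->
          y i b = 0 /\ w i b = 0].
Proof.
move=> [rs sV sE bs bE] [[mu_ge0 mu1] X01 zv ze zl].
set x := mixed_point G f X in zv ze zl.
pose lam B := if B \in s then marginal mu f B else fun=> 0.
pose y i := if i \in gLp G then marginal (fun o => mu o * X o i) f (beta i) else fun=> 0.
pose w i := if i \in gLp G then marginal (fun o => mu o * X o i ^+ 2) f (beta i) else fun=> 0.
have lamE B : B \in s -> lam B = marginal mu f B by rewrite /lam => ->.
have yE i : i \in gLp G -> y i = marginal (fun o => mu o * X o i) f (beta i).
  by rewrite /y => ->.
have wE i : i \in gLp G -> w i = marginal (fun o => mu o * X o i ^+ 2) f (beta i).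
  by rewrite /w => ->.
have xp o v : v \in gLp G -> x o v = X o v by rewrite /x /mixed_point => ->.
have xn o v : v \notin gLp G -> x o v = (v \in f o)%:R.
  by rewrite /x /mixed_point => /negbTE->.
have sum1 (nu : O -> R) B : \sum_(b in powerset B) marginal nu f B b = \sum_o nu o.
  transitivity (\sum_(b in powerset B) marginal nu f B b * 1).
    by apply: eq_bigr => b _; rewrite mulr1.
  by rewrite (sum_marginal nu f B (fun=> 1)); apply: eq_bigr => o _; rewrite mulr1.
exists lam, y, w; split; last 2 first.
- move=> B b; rewrite /lam; case: ifP => //= _ nb.
  by apply: marginal_outside; rewrite powersetE.
- move=> i b; rewrite /y /w; case: ifP => //= _ nb.
  by rewrite !marginal_outside ?powersetE.
split=> [B Bs|].
  rewrite lamE //; split=> [b _|]; first exact: sumr_ge0.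
  split=> [|C Cs a _]; first by rewrite sum1.
  by rewrite lamE // !sum_marginal_set1 setIC.
split=> [v vn B Bs vB|].
  rewrite lamE // sum_marginal zv; apply: eq_bigr => o _.
  by rewrite xn // inE vB andbT.
split=> [e e1n e2n B Bs e1B e2B|].
  rewrite lamE // (sum_marginal mu f B (fun b => _ * _)) ze; apply: eq_bigr => o _.
  by rewrite !xn // !inE e1B e2B !andbT.
split=> [i ip|].
  split=> [b _|]; last first.
    by rewrite yE // sum1 zv; apply: eq_bigr => o _; rewrite xp.
  rewrite yE // wE // lamE ?bs //.
  have muX o : 0 <= mu o * X o i <= mu o.
    by have /andP[X0 X1] := X01 o i; rewrite mulr_ge0 //= ler_piMr.
  split; last split.
  - split; first by apply: sumr_ge0 => o _; have /andP[] := muX o.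
    by apply: ler_sum => o _; have /andP[] := muX o.
  - by apply: sumr_ge0 => o _; rewrite mulr_ge0 ?sqr_ge0.
  - exact: sumr_ge0.
  - exact: weighted_cauchy_schwarz.
split=> [e|l].
  have [e1 e2] := bE _ (valP e); split=> [e1p|e2p].
    have [e2n e2b] := e1 e1p; rewrite yE // sum_marginal ze; apply: eq_bigr => o _.
    by rewrite xp // xn // inE e2b andbT mulrA.
  have [e1n e1b] := e2 e2p; rewrite yE // sum_marginal ze; apply: eq_bigr => o _.
  by rewrite xn // xp // inE e1b andbT mulrA mulrAC.
have := zl l; case: ifPn => // lp; rewrite wE // sum1; congr (_ <= _).
by apply: eq_bigr => o _; rewrite xp.
Qed.

(** After gluing the laws, each plus coordinate is set to its conditional mean given the trace on
    its bag. This keeps all moments linear in that coordinate and can only lower its second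
    moment. *)
Lemma local_moments_mixed n (G : graphL n) s beta (z : qpcoord G -> R) lam y w :
  adapted_bags G s beta -> local_moments s beta z lam y w ->
  exists (O : finType) (mu : O -> R) (f : O -> {set 'I_n}) (X : O -> 'I_n -> R),
    mixed_moments mu f X z.
Proof.
move=> [rs sV sE bs bE] [hlam [hv [he [hi [hei hl]]]]].
have [B b Bs bB|B Bs|B C a Bs Cs aBC|O [mu [f [mu_ge0 mu1 mu_marg]]]] :=
    glue_marginals (lam := lam) rs.
- by have [+ _] := hlam B Bs; apply.
- by have [_ [+ _]] := hlam B Bs.
- by have [_ [_ +]] := hlam B Bs; apply.
pose X o i := if i \in gLp G then y i (f o :&: beta i) / lam (beta i) (f o :&: beta i) else 0.
have expect B (h : {set 'I_n} -> R) : B \in s ->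
    \sum_(b in powerset B) lam B b * h b = \sum_o mu o * h (f o :&: B).
  by move=> Bs; rewrite -sum_marginal; apply: eq_bigr => b bB; rewrite mu_marg.
(* On an event of probability 0, [0 <= y <= lam] forces [y = 0], so the default value of the
   quotient does no harm. *)
have divlam i b : i \in gLp G -> b \in powerset (beta i) ->
    lam (beta i) b * (y i b / lam (beta i) b) = y i b.
  move=> ip bb; have [/(_ b bb)[[y0 yl] _] _] := hi i ip.
  have [l0|l0] := eqVneq (lam (beta i) b) 0; last by rewrite mulrC divfK.
  by rewrite l0 mul0r; apply/eqP; rewrite eq_le y0 -l0 yl.
have expectX i (h : {set 'I_n} -> R) : i \in gLp G ->
    \sum_o mu o * (X o i * h (f o :&: beta i)) = \sum_(b in powerset (beta i)) y i b * h b.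
  move=> ip; transitivity (\sum_(b in powerset (beta i))
      lam (beta i) b * (y i b / lam (beta i) b * h b)).
    by rewrite (expect _ (fun b => _ * _)) ?bs // /X ip.
  by apply: eq_bigr => b bb; rewrite mulrA divlam.
exists O, mu, f, X.
set x := mixed_point G f X.
have xp o v : v \in gLp G -> x o v = X o v by rewrite /x /mixed_point => ->.
have xn o v : v \notin gLp G -> x o v = (v \in f o)%:R.
  by rewrite /x /mixed_point => /negbTE->.
split=> // [o i|v|e|l]; rewrite -/x.
- rewrite /X; case: ifPn => [ip|_]; last by rewrite lexx ler01.
  have bb : f o :&: beta i \in powerset (beta i) by rewrite powersetE subsetIr.
  have [/(_ _ bb)[[y0 yl] [_ l0 _]] _] := hi i ip.
  rewrite divr_ge0 //=; have [->|ln0] := eqVneq (lam (beta i) (f o :&: beta i)) 0.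
    by rewrite invr0 mulr0 ler01.
  by rewrite ler_pdivrMr ?mul1r // lt_def ln0.
- have [vp|vn] := boolP (v \in gLp G).
    have [_ ->] := hi v vp; transitivity (\sum_(b in powerset (beta v)) y v b * 1).
      by apply: eq_bigr => b _; rewrite mulr1.
    by rewrite -(expectX _ (fun=> 1)) //; apply: eq_bigr => o _; rewrite mulr1 -xp.
  have [B Bs vB] := sV v vn; rewrite (hv v vn B) // (expect B (fun b => (v \in b)%:R)) //.
  by apply: eq_bigr => o _; rewrite xn // inE vB andbT.
- have [e1 e2] := bE _ (valP e); have [h1 h2] := hei e.
  have [e1p|e1n] := boolP ((val e).1 \in gLp G).
    have [e2n e2b] := e1 e1p; rewrite h1 // -(expectX _ (fun b => (_ \in b)%:R)) //.
    by apply: eq_bigr => o _; rewrite xp // xn // inE e2b andbT.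
  have [e2p|e2n] := boolP ((val e).2 \in gLp G).
    have [_ e1b] := e2 e2p; rewrite h2 // -(expectX _ (fun b => (_ \in b)%:R)) //.
    by apply: eq_bigr => o _; rewrite xn // xp // inE e1b andbT mulrC (mulrC (X _ _)) mulrC.
  have [B [Bs e1B e2B]] := sE _ (valP e) e1n e2n.
  rewrite (he e e1n e2n B) // (expect B (fun b => _ * _)) //.
  by apply: eq_bigr => o _; rewrite !xn // !inE e1B e2B !andbT.
(* The second moment is the sum of y^2 / lam, and the cone constraint bounds each term by [w]. *)
have := hl l; case: ifPn => // lp; apply: le_trans.
have bl := bs _ lp; have [hlp _] := hi _ lp.
under eq_bigr do rewrite xp // /X lp.
rewrite -(expect _ (fun b => (y (val l) b / lam (beta (val l)) b) ^+ 2)) //.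
apply: ler_sum => b bb; have [_ [w0 l0 ywl]] := hlp b bb.
have [E0|ln0] := eqVneq (lam (beta (val l)) b) 0; first by rewrite E0 mul0r.
have {}l0 : 0 < lam (beta (val l)) b by rewrite lt_def ln0.
rewrite expr2 mulrA divlam // mulrA -expr2 ler_pdivrMr //.
Qed.

(** * Counting constraints and auxiliary variables *)

Notation local_key n := (({set 'I_n} + ('I_n + 'I_n)) * {set 'I_n})%type.

(** The keys of type [inl] index [lam], the two [inr] families index [y] and [w]; only traces on the
    relevant bags are kept. *)
Definition local_dom n (G : graphL n) (s : seq {set 'I_n}) (beta : 'I_n -> {set 'I_n}) :
    pred (local_key n) := fun q => match q.1 with
  | inl B => (B \in s) && (q.2 \subset B)
  | inr (inl i) | inr (inr i) => (i \in gLp G) && (q.2 \subset beta i)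
  end.

Ltac affine_tac :=
  by repeat first [exact: affine_coord | apply: affineMr | apply: affine_sum => ? _
                  | exact: affine_cst].

Lemma soc_set_local_moments n (G : graphL n) (s : seq {set 'I_n}) (beta : 'I_n -> {set 'I_n})
    (N W : nat) :
  (forall i, i \in gLp G -> beta i \in s) -> (size s <= N)%N -> (n <= N)%N -> (0 < W)%N ->
  (forall B, B \in s -> 2 ^ #|B| <= W)%N ->
  soc_set (19 * (N ^ 3 * W)) (fun x : qpcoord G + local_key n -> R =>
    local_moments s beta (fun c => x (inl c)) (fun B b => x (inr (inl B, b)))
      (fun i b => x (inr (inr (inl i), b))) (fun i b => x (inr (inr (inr i), b)))).
Proof.
move=> bs szs nN W0 sW.
have cardP B : B \in s -> (#|powerset B| <= W)%N by move=> Bs; rewrite card_powerset sW.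
have cardE : (#|{: {e | e \in gE G}}| <= N * N)%N.
  rewrite card_sig; apply: leq_trans (max_card _) _.
  by rewrite card_prod card_ord leq_mul.
have cardL : (#|{: {i | i \in gL G}}| <= N)%N.
  by rewrite card_sig; apply: leq_trans (max_card _) _; rewrite card_ord.
have cardI : (#|'I_n| <= N)%N by rewrite card_ord.
have cardLp : (#|gLp G| <= N)%N by apply: leq_trans (max_card _) cardI.
have allb B k (S : {set 'I_n} -> (qpcoord G + local_key n -> R) -> Prop) : B \in s ->
    (forall b, soc_set k (S b)) -> soc_set (W * k) (fun x => forall b, b \in powerset B -> S b x).
  move=> Bs Sb; apply: soc_set_leq (soc_set_all (fun b _ => Sb b)).
  by rewrite leq_mul2r cardP ?orbT.
have allB k (S : {set 'I_n} -> (qpcoord G + local_key n -> R) -> Prop) :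
    (forall B, B \in s -> soc_set k (S B)) ->
    soc_set (N * k) (fun x => forall B, B \in s -> S B x).
  move=> SB; apply: soc_set_leq (soc_set_all_seq SB).
  by rewrite leq_mul2r szs orbT.
have allT (T : finType) M k (S : T -> (qpcoord G + local_key n -> R) -> Prop) :
    (#|T| <= M)%N -> (forall t, soc_set k (S t)) -> soc_set (M * k) (fun x => forall t, S t x).
  by move=> cT St; apply: soc_set_leq (soc_set_forall St); rewrite leq_mul2r cT orbT.
(* The count follows the clauses of [local_moments] in order; once expanded, its coefficients sum to
   19 and each monomial is at most [N ^ 3 * W]. *)
apply: (@soc_set_leq _ (N * (W * 1 + (2 + N * (W * 2))) + (N * (N * 2) + (N * N * (N * 2) +
   (N * (W * (1 + 1 + 1) + 2) + (N * N * (2 + 2) + N * 1)))))).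
  have [->|N0] := posnP N; first by [].
  have le_mul a b : (0 < b)%N -> (a <= a * b)%N by case: b => // b _; rewrite mulnS leq_addr.
  have := le_mul N N N0; have := le_mul (N * N) N N0; have := le_mul N W W0.
  have := le_mul (N * N) W W0; have := le_mul (N * N * N) W W0; have := le_mul (N * W) N N0.
  have := le_mul (N * N * W) N N0; rewrite !expnS expn0; lia.
apply: soc_set_and.
  apply: (allB) => B Bs; apply: soc_set_and.
    by apply: (allb) => // b; apply: soc_set_ge0; affine_tac.
  apply: soc_set_and; first by apply: soc_set_eq; affine_tac.
  apply: (allB) => C Cs; apply: soc_set_leq (soc_set_all (k := 2) _) => [|a _].
    rewrite leq_mul2r; apply: leq_trans (cardP _ Bs).
    by apply: subset_leq_card; rewrite powersetS subsetIl.
  by apply: soc_set_eq; affine_tac.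
apply: soc_set_and.
  apply: (allT) => // v; apply: soc_set_imply => _; apply: (allB) => B _.
  by apply: soc_set_imply => _; apply: soc_set_eq; affine_tac.
apply: soc_set_and.
  apply: (allT) => // e; do 2 apply: soc_set_imply => _; apply: (allB) => B _.
  by do 2 apply: soc_set_imply => _; apply: soc_set_eq; affine_tac.
apply: soc_set_and.
  apply: (allT) => // i; apply: soc_set_imply => ip; apply: soc_set_and.
    apply: (allb) => [|b]; first exact: bs.
    apply: soc_set_and; last by apply: soc_set_rotated; affine_tac.
    apply: soc_set_and; first by apply: soc_set_ge0; affine_tac.
    by apply: soc_set_le; affine_tac.
  by apply: soc_set_eq; affine_tac.
apply: soc_set_and.
  apply: (allT) => // e; apply: soc_set_and.
    by apply: soc_set_imply => _; apply: soc_set_eq; affine_tac.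
  by apply: soc_set_imply => _; apply: soc_set_eq; affine_tac.
apply: (allT) => // l; case: (val l \in gLp G).
  by apply: soc_set_le; affine_tac.
by apply: soc_set_le; affine_tac.
Qed.

Lemma card_local_dom n (G : graphL n) (s : seq {set 'I_n}) (beta : 'I_n -> {set 'I_n})
    (N W : nat) :
  (forall i, i \in gLp G -> beta i \in s) -> (size s <= N)%N -> (n <= N)%N ->
  (forall B, B \in s -> 2 ^ #|B| <= W)%N ->
  (#|local_dom G s beta| <= 3 * (N * W))%N.
Proof.
move=> bs szs nN sW.
have cardP B : B \in s -> (\sum_(b : {set 'I_n} | b \subset B) 1 <= W)%N.
  move=> Bs; apply: leq_trans (sW B Bs); rewrite -card_powerset -sum1_card.
  by rewrite leq_eqVlt; apply/orP; left; apply/eqP; apply: eq_bigl => b; rewrite powersetE.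
have sum_sub (T : finType) (A : pred T) (h : T -> {set 'I_n}) (M : nat) :
    (forall t, A t -> h t \in s) -> (#|A| <= M)%N ->
    (\sum_t \sum_(b : {set 'I_n}) (if A t && (b \subset h t) then 1 else 0) <= M * W)%N.
  move=> As cA; apply: leq_trans (_ : \sum_(t in A) W <= _)%N; last first.
    by rewrite sum_nat_const leq_mul2r cA orbT.
  rewrite [leqRHS]big_mkcond; apply: leq_sum => t _; rewrite unfold_in.
  case: (boolP (A t)) => [At|_] /=; last by rewrite big1.
  by rewrite -big_mkcond /= cardP ?As.
rewrite -sum1_card big_mkcond /=.
rewrite -(pair_bigA _ (fun k b => if (k, b) \in local_dom G s beta then 1%N else 0%N)) /=.
rewrite !big_sumType /= mulSn mul2n -addnn; apply: leq_add; last apply: leq_add.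
- by apply: (sum_sub _ (mem s) id) => //; apply: leq_trans szs; apply: card_size.
- by apply: (sum_sub _ (mem (gLp G)) beta) => //; apply: leq_trans (max_card _) _; rewrite card_ord.
- by apply: (sum_sub _ (mem (gLp G)) beta) => //; apply: leq_trans (max_card _) _; rewrite card_ord.
Qed.

(** * Merging the bags of a plus node *)

Lemma arcs_in_tree m (T : rel 'I_m) : is_tree T -> arcs_in T [set: 'I_m] = m.-1.*2.
Proof.
move=> [_ [symT [irrT [_ <-]]]]; rewrite /arcs_in -sum1_card [X in _ = X.*2]big_mkcond /=.
rewrite (eq_bigr (fun p => T p.1 p.2 && (p.1 < p.2)%N : nat)); last first.
  by move=> p _; rewrite inE; case: (_ && _).
rewrite -(pair_bigA _ (fun a b : 'I_m => T a b && (a < b)%N : nat)) /= -addnn.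
rewrite [X in _ = (_ + X)%N]exchange_big /= -big_split /=.
apply: eq_big => [a|a _]; first by rewrite inE.
rewrite -big_split /=; apply: eq_big => [b|b _]; first by rewrite inE.
rewrite [T b a]symT; case: (ltngtP a b) => [_|_|/val_inj->]; last by rewrite irrT.
  by case: (T a b).
by case: (T a b).
Qed.

Lemma card_bigcup_leq (I V : finType) (P : pred I) (A : I -> {set V}) :
  (#|\bigcup_(i | P i) A i| <= \sum_(i | P i) #|A i|)%N.
Proof.
apply: (big_ind2 (fun (B : {set V}) k => (#|B| <= k)%N)) => [|B k C l Bk Cl|//].
  by rewrite cards0.
by apply: leq_trans (leq_add Bk Cl); rewrite cardsU leq_subr.
Qed.

(** Bag [j] absorbs every bag sharing a plus node with it. The index set and the tree are unchanged,
    so equal bags may be repeated. *)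
Definition merged_bag n (G : graphL n) m (X : 'I_m -> {set 'I_n}) (j : 'I_m) : {set 'I_n} :=
  [set v | (v \notin gLp G) && [exists a, (v \in X a) &&
     ((a == j) || [exists i, [&& i \in gLp G, i \in X a & i \in X j]])]].

Lemma mem_merged_bag n (G : graphL n) m (X : 'I_m -> {set 'I_n}) v a :
  v \notin gLp G -> v \in X a -> v \in merged_bag G X a.
Proof. by move=> vn va; rewrite inE vn; apply/existsP; exists a; rewrite va eqxx. Qed.

Lemma mem_merged_bag_plus n (G : graphL n) m (X : 'I_m -> {set 'I_n}) i v a j :
  i \in gLp G -> i \in X a -> i \in X j -> v \notin gLp G -> v \in X a ->
  v \in merged_bag G X j.
Proof.
move=> ip ia ij vn va; rewrite inE vn; apply/existsP; exists a; rewrite va /=.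
by apply/orP; right; apply/existsP; exists i; rewrite ip ia ij.
Qed.

(** A bag without plus node absorbs nothing. If [i] is its only plus node, the merged bag lies in
    the union of the [X a :\ i] over the bags containing [i], whose sizes sum to the spread. *)
Lemma card_merged_bag n (G : graphL n) m (X : 'I_m -> {set 'I_n}) (j : 'I_m) :
  (forall j, (#|X j :&: gLp G| <= 1)%N) ->
  (#|merged_bag G X j| <= (width X).+1)%N \/
  exists2 i, i \in gLp G & (#|merged_bag G X j| <= spread X i)%N.
Proof.
move=> C1; have [X0|/set0Pn[i /setIP[ij ip]]] := eqVneq (X j :&: gLp G) set0.
  left; apply: leq_trans (leqSpred _); apply: leq_trans (leq_bigmax j).
  apply: subset_leq_card; apply/subsetP=> v; rewrite inE => /andP[_ /existsP[a /andP[va]]].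
  case/orP=> [/eqP<-//|/existsP[i /and3P[ip _ ij]]].
  by have := in_set0 i; rewrite -X0 inE ij ip.
right; exists i => //; apply: (@leq_trans #|\bigcup_(a | i \in X a) (X a :\ i)|).
  apply: subset_leq_card; apply/subsetP=> v; rewrite inE.
  case/andP=> vn /existsP[a /andP[va ha]].
  have ia : i \in X a.
    case/orP: ha => [/eqP->//|/existsP[i' /and3P[i'p i'a i'j]]].
    by rewrite ((card_le1_eqP (C1 j)) i' i) // inE ?ij ?i'j.
  apply/bigcupP; exists a => //; rewrite !inE va andbT.
  by apply: contraNneq vn => ->.
apply: leq_trans (card_bigcup_leq _ _) _; apply: leq_sum => a ia.
by rewrite (cardsD1 i (X a)) ia.
Qed.

(** If [v] entered bag [j] through a plus node [i], every bag along the subtree of [i] has absorbed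
    [v] too. Following it leads to a bag originally containing [v], and the subtree of [v] joins any
    two of these. *)
Lemma merged_bag_connected n (G : graphL n) m (X : 'I_m -> {set 'I_n}) (T : rel 'I_m) v :
  tree_decomposition G X T -> connected_in T [set j | v \in merged_bag G X j].
Proof.
move=> [[_ [symT _]] [_ [_ conn]]].
set A := [set j | _].
have symA : connect_sym (restr T A).
  by apply: sym_connect_sym => a b; rewrite /restr /= symT; congr (_ && _); apply: andbC.
have to_orig j : j \in A -> exists2 a, v \in X a & connect (restr T A) j a.
  rewrite !inE => /andP[vn /existsP[a /andP[va /orP[/eqP<-|/existsP[i /and3P[ip ia ij]]]]]].
    by exists a.
  exists a => //; apply: (@connect_sub _ _ _ _ j a (conn i j a ij ia)) => x y /and3P[xy ix iy].
  apply: connect1; rewrite /restr /= xy /= ![_ \in A]inE.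
  by rewrite (mem_merged_bag_plus ip ia ix) // (mem_merged_bag_plus ip ia iy).
move=> j k jA kA; have [a va ja] := to_orig j jA; have [b vb kb] := to_orig k kA.
apply: connect_trans ja _; rewrite symA; apply: connect_trans kb _.
have vn : v \notin gLp G by move: jA; rewrite !inE => /andP[].
apply: (@connect_sub _ _ _ _ b a (conn v b a vb va)) => x y /and3P[xy vx vy].
by apply: connect1; rewrite /restr /= xy /= ![_ \in A]inE !mem_merged_bag.
Qed.

Lemma adapted_bags_exist n (G : graphL n) m (X : 'I_m -> {set 'I_n}) (T : rel 'I_m) :
  tree_decomposition G X T -> (forall j, (#|X j :&: gLp G| <= 1)%N) ->
  exists (s : seq {set 'I_n}) (beta : 'I_n -> {set 'I_n}),
    [/\ adapted_bags G s beta, (size s <= n.+1)%N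
      & forall B, B \in s -> (#|B| <= (width X).+1)%N \/
          exists2 i, i \in gLp G & (#|B| <= spread X i)%N].
Proof.
move=> td C1; have [tree [cov [ecov conn]]] := td.
have [_ [symT [irrT [connT _]]]] := tree.
have [||v|s [rs ss sY Ys]] :=
    @running_intersection_of_tree _ _ T (merged_bag G X) setT symT irrT.
- by rewrite arcs_in_tree // cardsT card_ord.
- move=> a b _ _; rewrite (@eq_connect _ _ T) // => x y.
  by rewrite /restr /= !inE !andbT.
- by rewrite setTI; apply: merged_bag_connected td.
(* Any listed bag containing the merged bag of some [X j] with [i] in it serves: that merged bag
   already holds all neighbours of [i]. *)
pose beta i := odflt set0
  [pick B | (B \in s) && [exists j, (i \in X j) && (merged_bag G X j \subset B)]].
have betaP i : beta i \in s /\ exists2 j, i \in X j & merged_bag G X j \subset beta i.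
  rewrite /beta; case: pickP => [B /andP[Bs /existsP[j /andP[ij sub]]]|none].
    by split=> //; exists j.
  have [j ij] := cov i; have [B Bs sub] := Ys j (in_setT j).
  by have := none B; rewrite Bs => /= /existsP[]; exists j; rewrite ij.
exists s, beta; split; last 2 first.
- by apply: leq_trans ss _; rewrite ltnS; apply: leq_trans (max_card _) _; rewrite card_ord.
- move=> B /sY[->|[j _ ->]]; first by left; rewrite cards0.
  exact: card_merged_bag.
have plus_edge i v a : i \in gLp G -> i != v -> i \in X a -> v \in X a ->
    v \notin gLp G /\ v \in beta i.
  move=> ip niv ia va; have vn : v \notin gLp G.
    apply: contra niv => vp.
    by rewrite ((card_le1_eqP (C1 a)) i v) // inE ?ia ?va.
  split=> //; have [_ [j ij sub]] := betaP i; apply: (subsetP sub).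
  exact: mem_merged_bag_plus ip ia ij vn va.
split=> //.
- move=> v vn; have [j vj] := cov v; have [B Bs sub] := Ys j (in_setT j).
  by exists B => //; apply: (subsetP sub); apply: mem_merged_bag.
- move=> e eE e1n e2n; have [j /andP[e1j e2j]] := ecov e eE.
  have [B Bs sub] := Ys j (in_setT j).
  by exists B; split=> //; apply: (subsetP sub); apply: mem_merged_bag.
- by move=> i _; have [] := betaP i.
move=> e eE; have [a /andP[e1a e2a]] := ecov e eE.
have ne : e.1 != e.2 by have := gE_wf eE; apply: contraTneq => ->; rewrite ltnn.
split=> ep; first exact: (plus_edge _ _ a).
by apply: (plus_edge _ _ a) => //; rewrite eq_sym.
Qed.

(** * Logarithmic bag sizes and the polynomial bound *)

(** Since 2 <= e, 2^k is at most e^(c ln n), and [Num.bound c] is a natural exponent above [c]. The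
    base [n.+1] covers n = 0, where [ln] is 0 by convention. *)
Lemma expn2_le_of_ln (c : R) (n k : nat) : 0 < c -> k%:R <= c * ln (n%:R : R) ->
  (2 ^ k <= n.+1 ^ Num.bound c)%N.
Proof.
move=> c_gt0 kc; rewrite -(ler_nat R) !natrX.
have ln_ge0' : 0 <= ln (n.+1%:R : R) by rewrite ln_ge0 // ler1n.
have le_ln : ln (n%:R : R) <= ln (n.+1%:R : R).
  case: n {kc} ln_ge0' => [|n] h; first by rewrite ln0.
  by rewrite ler_ln ?posrE ?ltr0n // ler_nat.
have two_le : 2 <= expR 1 :> R by have := expR_ge1Dx (1 : R).
apply: le_trans (_ : expR 1 ^+ k <= _); first by rewrite lerXn2r ?nnegrE ?expR_ge0.
rewrite -expRM_natl mulr1 -[X in X ^+ Num.bound c]lnK ?posrE ?ltr0n // -expRM_natl ler_expR.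
apply: le_trans kc _; apply: le_trans (_ : c * ln n.+1%:R <= _); first by rewrite ler_wpM2l // ltW.
by rewrite ler_wpM2r // ltW // archi_boundP // ltW.
Qed.

Theorem theorem3 (c : R) (hc : 0 < c) :
  exists K d : nat,
  forall (n : nat) (G : graphL n) (m : nat) (X : 'I_m -> {set 'I_n}) (T : rel 'I_m),
    tree_decomposition G X T ->
    (forall j, (#|X j :&: gLp G| <= 1)%N) ->
    (width X)%:R <= c * ln (n%:R : R) ->
    (forall i, i \in gLp G -> (spread X i)%:R <= c * ln (n%:R : R)) ->
    exists F : socForm (qpcoord G),
      SOC_formulation (QP G) F /\ (socForm_size F <= K * n ^ d + K)%N.
Proof.
(* The 3 comes from the factor [N ^ 3] in the constraint count, the bound on [c] from the number of
   traces on a bag. *)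
pose d := (3 + Num.bound c)%N.
exists (50 * 2 ^ d)%N, d => n G m X T td C1 C2 C3.
have [s [beta [ab ss sB]]] := adapted_bags_exist td C1.
(* The factor 2 pays for the width being the bag size minus one. *)
pose W := (2 * n.+1 ^ Num.bound c)%N.
have W_gt0 : (0 < W)%N by rewrite muln_gt0 expn_gt0.
have sW B : B \in s -> (2 ^ #|B| <= W)%N.
  case/sB=> [Bw|[i ip Bi]].
    by apply: leq_trans (leq_pexp2l _ Bw) _; rewrite // expnS leq_mul2l (expn2_le_of_ln hc).
  apply: leq_trans (leq_pexp2l _ Bi) _ => //.
  by apply: leq_trans (expn2_le_of_ln hc (C3 i ip)) _; rewrite leq_pmull.
have [rs sV sE bs bE] := ab.
have [F [szF FE]] := soc_set_projection (local_dom G s beta)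
  (soc_set_local_moments bs ss (leqnSn n) W_gt0 sW).
exists F; split=> [z|].
  rewrite FE QP_mixed_moments; split=> [[O [mu [f [X' mm]]]]|[u [_ lm]]].
    have [lam [y [w [lm lam0 yw0]]]] := mixed_moments_local ab mm.
    exists (fun q => match q.1 with
      | inl B => lam B q.2 | inr (inl i) => y i q.2 | inr (inr i) => w i q.2 end).
    split=> // -[[B|[i|i]] b] nD /=; first exact: lam0.
      by have [] := yw0 i b nD.
    by have [] := yw0 i b nD.
  exact: local_moments_mixed ab lm.
have cardI : (#|qpcoord G| <= n.+1 + (n.+1 * n.+1 + n.+1))%N.
  rewrite !card_sum card_ord !card_sig; apply: leq_add => //; apply: leq_add.
    apply: leq_trans (max_card _) _.
    by rewrite card_prod card_ord leq_mul.
  by apply: leq_trans (max_card _) _; rewrite card_ord.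
have cardD := card_local_dom bs ss (leqnSn n) sW.
(* 25 = 3 + 3 + 19: coordinates, auxiliary variables and constraints. The factor 2 in [W] turns it
   into 50. *)
apply: (@leq_trans (25 * (n.+1 ^ 3 * W))).
  apply: leq_trans szF _; apply: leq_trans (leq_add (leq_add cardI cardD) (leqnn _)) _.
  have le_mul a b : (0 < b)%N -> (a <= a * b)%N by case: b => // b _; rewrite mulnS leq_addr.
  move: (n.+1) (ltn0Sn n) => N N0.
  have := le_mul N N N0; have := le_mul (N * N) N N0.
  have := le_mul (N * N * N) W W_gt0; have := le_mul (N * W) N N0.
  have := le_mul (N * N * W) N N0; rewrite !expnS expn0; lia.
rewrite /W [(_ ^ 3 * _)%N]mulnCA -expnD -/d mulnA.
(* For n > 0, [n.+1 <= 2 * n]; the additive term takes care of n = 0. *)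
have le_pow : (n.+1 ^ d <= 2 ^ d * n ^ d + 2 ^ d)%N.
  case: (n) => [|k]; first by rewrite exp1n; apply: leq_trans (leq_addl _ _); rewrite expn_gt0.
  by apply: leq_trans (leq_addr _ _); rewrite -expnMn leq_exp2r //; lia.
by apply: leq_trans (leq_mul (leqnn _) le_pow) _; rewrite mulnDr mulnA.
Qed.
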